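(* Let $f:\mathbb{R}^d\to(0,\infty]$ be a density satisfying assumption (A) with constants $C_1,C_2\ge1$, and let $M_2:=(C_1\vee C_2)\|f\|_1$. Then $$\lambda e^{-\lambda\|f\|_1}f(x)\le p_\lambda(x)\le e^{(M_2-\|f\|_1)\lambda}\,\lambda f(x),\qquad |x|<1,\ \lambda>0,$$ and $$1\le\frac{p_\lambda(x)}{e^{-\lambda\|f\|_1}f(x)\sum_{n=1}^\infty\frac{\lambda^nh_n(x)}{n!}}\le e^{M_2\lambda},\qquad |x|\ge1,\ \lambda>0.$$ Moreover, in the second estimate the functions $h_n$ can be replaced by the functions $g_n$ without changing the constants.
   Context: Let $d\ge 1$, $\mathbb{N}=\{1,2,\dots\}$, $a\vee b=\max(a,b)$; $|x|$ is the Euclidean norm and $\|f\|_1$ the $L^1(\mathbb{R}^d)$ norm (Lebesgue measure). A density is a nonnegative nonzero function in $L^1(\mathbb{R}^d)$. ''Decreasing'' is meant in the non-strict sense; a function is radial decreasing if $f(x)=F(|x|)$ with $F$ nonincreasing on $[0,\infty)$. Convolutions: $f^{1\star}:=f$, $f^{n\star}(x):=\int_{\mathbb{R}^d}f(x-y)f^{(n-1)\star}(y)\,dy$ for $n\ge2$. For $\lambda>0$ the (density of the) compound Poisson measure built for $f$ is $$p_\lambda(x)=e^{-\lambda\|f\|_1}\sum_{n=1}^\infty\frac{\lambda^nf^{n\star}(x)}{n!}.$$ Assumption (A): $f:\mathbb{R}^d\to(0,\infty]$ is a density such that (a) $f$ is a radial decreasing function; (b) there is a constant $C_1\ge1$ such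 that $f(x)\le C_1f(y)$ for $1\le|x|\le|y|\le|x|+1$; (c) there is a constant $C_2\ge1$ such that $f(x)\le C_2f(2x)$ for $|x|\le1$. Functions $h_n,g_n$: $h_1\equiv g_1\equiv1$ on $\mathbb{R}^d$ and, for $n\in\mathbb{N}$, $$h_{n+1}(x):=\frac{\int_{D(x)}f(x-y)f(y)h_n(y)\,dy}{f(x)},\qquad g_{n+1}(x):=\frac{\int_{E(x)}f(x-y)f(y)g_n(y)\,dy}{f(x)},$$ where $D(x)=\{z\in\mathbb{R}^d:|z|<|x|-1,\ |x-z|<|x|-1\}$ and $E(x)=\{z\in\mathbb{R}^d:|z|<|x|,\ |x-z|<|x|\}$. An integral over the empty set equals $0$ and $a/(+\infty)=0$ for $a\ge0$. *)

(* Defs.v *)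
From HB Require Import structures.
From mathcomp Require Import all_boot all_order all_algebra.
From mathcomp Require Import all_classical all_reals all_analysis.

Set Implicit Arguments.
Unset Strict Implicit.
Unset Printing Implicit Defensive.

Import Order.TTheory GRing.Theory Num.Theory.
Import numFieldNormedType.Exports.

Local Open Scope classical_set_scope.
Local Open Scope ring_scope.

Definition measure_rV_display : measure_display -> measure_display.
Proof. exact. Qed.

(* The product sigma-algebra, generated by the coordinate maps; for T the reals
   it is the Borel sigma-algebra of R^n. *)
Section measurable_rV.
Context {d} {T : measurableType d}.
Variable n : nat.

Let coord : 'I_n -> 'rV[T]_n -> T := fun i v => v ord0 i.

Let rV_set0 : g_sigma_preimage coord set0.
Proof. exact: sigma_algebra0. Qed.

Let rV_setC A : g_sigma_preimage coord A -> g_sigma_preimage coord (~` A).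
Proof. exact: sigma_algebraC. Qed.

Let rV_bigcup (F : (set 'rV[T]_n)^nat) :
  (forall i, g_sigma_preimage coord (F i)) ->
  g_sigma_preimage coord (\bigcup_i (F i)).
Proof. exact: sigma_algebra_bigcup. Qed.

HB.instance Definition _ := @isMeasurable.Build (measure_rV_display d)
  ('rV[T]_n) (g_sigma_preimage coord) rV_set0 rV_setC rV_bigcup.

Lemma measurable_coord (i : 'I_n) :
  measurable_fun [set: 'rV[T]_n] (fun v : 'rV[T]_n => v ord0 i).
Proof.
move=> _ Y mY; rewrite setTI; apply: sub_sigma_algebra => /=.
rewrite -bigcup_seq/=; exists i => /=; first by rewrite mem_index_enum.
by exists Y => //; rewrite setTI.
Qed.

Lemma measurable_fun_rVP d' (T' : measurableType d') (f : T' -> 'rV[T]_n) :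
  measurable_fun [set: T'] f <->
  forall i, measurable_fun [set: T'] (fun t => f t ord0 i).
Proof.
split=> [mf i|mf].
  exact: measurableT_comp (measurable_coord i) mf.
have H : g_sigma_preimage (fun i => coord i \o f) `<=` measurable.
  apply: smallest_sub; first exact: sigma_algebra_measurable.
  rewrite -bigcup_seq => A [i /= _ [B mB <-]]; exact: mf.
by rewrite g_sigma_preimage_comp in H => _ A mA; apply: H; exists A.
Qed.

End measurable_rV.

Section lebesgue_rV.
Context {R : realType}.
Local Open Scope ereal_scope.

Definition row_cons n (p : 'rV[R]_n * R) : 'rV[R]_n.+1 :=
  \row_(i < n.+1) oapp (p.1 ord0) p.2 (unlift ord0 i).

Lemma measurable_row_cons n : measurable_fun setT (@row_cons n).
Proof.
apply/measurable_fun_rVP => i.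
rewrite [X in measurable_fun _ X](_ : _ =
  fun p : 'rV[R]_n * R => oapp (p.1 ord0) p.2 (unlift ord0 i)); last first.
  by apply/funext => p; rewrite mxE.
case: (unlift ord0 i) => [j|] /=; last exact: measurable_snd.
exact: measurableT_comp (measurable_coord j) measurable_fst.
Qed.

Section lebesgue_cons.
Variables (n : nat) (mu : {measure set 'rV[R]_n -> \bar R}).

Definition lebesgue_cons : set 'rV[R]_n.+1 -> \bar R :=
  pushforward (mu \x (@lebesgue_measure R)) (@row_cons n).

Let lebesgue_cons0 : lebesgue_cons set0 = 0.
Proof. by rewrite /lebesgue_cons /pushforward preimage_set0 measure0. Qed.

Let lebesgue_cons_ge0 A : 0 <= lebesgue_cons A.
Proof. exact: (measure_ge0 (mu \x (@lebesgue_measure R))). Qed.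

Let lebesgue_cons_sigma_additive : semi_sigma_additive lebesgue_cons.
Proof.
have mc := @measurable_row_cons n.
move=> F mF tF mUF; rewrite /lebesgue_cons /pushforward preimage_bigcup.
apply: measure_semi_sigma_additive.
- by move=> k; rewrite -[X in measurable X]setTI; exact: mc.
- apply/trivIsetP => /= i j _ _ ij; rewrite -preimage_setI.
  by move/trivIsetP : tF => /(_ _ _ _ _ ij) ->//; rewrite preimage_set0.
- by rewrite -preimage_bigcup -[X in measurable X]setTI; exact: mc.
Qed.

HB.instance Definition _ := isMeasure.Build _ _ _ lebesgue_cons
  lebesgue_cons0 lebesgue_cons_ge0 lebesgue_cons_sigma_additive.

End lebesgue_cons.

Fixpoint lebesgue_rV_rec n : {measure set 'rV[R]_n -> \bar R} :=
  if n is m.+1 then lebesgue_cons (lebesgue_rV_rec m)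
  else dirac (0%R : 'rV[R]_0).

(* Lebesgue measure on R^n (restricted to the Borel sets), obtained from the
   n-fold product of the one-dimensional Lebesgue measure; it is characterized
   by [lebesgue_rV_box]. *)
Definition lebesgue_rV n : set 'rV[R]_n -> \bar R := lebesgue_rV_rec n.

HB.instance Definition _ n := Measure.on (@lebesgue_rV n).

Lemma lebesgue_rV_box n (A : 'I_n -> set R) :
  (forall i, measurable (A i)) ->
  lebesgue_rV [set v : 'rV[R]_n | forall i, A i (v ord0 i)] =
  \prod_(i < n) lebesgue_measure (A i).
Proof.
rewrite /lebesgue_rV; elim: n A => [|n IH] A mA.
  by rewrite big_ord0 /= diracE mem_set//= => -[].
rewrite big_ord_recl /= /lebesgue_cons /pushforward.
rewrite (_ : _ @^-1` _ =
  [set v : 'rV[R]_n | forall i, A (lift ord0 i) (v ord0 i)] `*` A ord0).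
  rewrite product_measure1E; last exact: mA.
    by rewrite muleC; congr (_ * _); exact: IH.
  rewrite (_ : [set v | _] = \bigcap_(i in setT)
    ((fun v : 'rV[R]_n => v ord0 i) @^-1` A (lift ord0 i))).
    apply: fin_bigcap_measurable => // i _.
    by rewrite -[X in measurable X]setTI; exact: measurable_coord.
  by apply/seteqP; split=> [v h i _|v h i]; exact: h.
apply/seteqP; split=> [[v t] /= h|[v t] /= [h1 h2] i].
  split=> [i|]; last by have := h ord0; rewrite mxE unlift_none.
  by have := h (lift ord0 i); rewrite mxE liftK.
by rewrite mxE; case: unliftP => [j ->|->] /=.
Qed.

End lebesgue_rV.

Section compound_poisson.
Context {R : realType} {d : nat}.
Implicit Types (x y : 'rV[R]_d) (f g : 'rV[R]_d -> \bar R).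

(* The library norm on row vectors is the sup norm, hence this definition. *)
Definition enorm x : R := Num.sqrt (\sum_(i < d) x ord0 i ^+ 2).

Local Open Scope ereal_scope.

Definition density f : Prop :=
  [/\ (@lebesgue_rV R d).-integrable setT f,
      forall x, 0 <= f x &
      ~ {ae @lebesgue_rV R d, forall x, f x = 0}].

Definition L1norm f : R := fine ('N[@lebesgue_rV R d]_1[f]).

Definition radial_decreasing f : Prop :=
  exists F : R -> \bar R,
    (forall r s : R, (0 <= r)%R -> (r <= s)%R -> F s <= F r) /\
    (forall x, f x = F (enorm x)).

Record assumption_A f (C1 C2 : R) : Prop := {
  A_density : density f ;
  A_pos : forall x, 0 < f x ;
  A_radial : radial_decreasing f ;
  A_C1_ge1 : (1 <= C1)%R ;
  A_C1 : forall x y, (1 <= enorm x)%R -> (enorm x <= enorm y)%R ->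
    (enorm y <= enorm x + 1)%R -> f x <= C1%:E * f y ;
  A_C2_ge1 : (1 <= C2)%R ;
  A_C2 : forall x, (enorm x <= 1)%R -> f x <= C2%:E * f (2%:R *: x)%R
}.

Definition convolution f g x : \bar R :=
  \int[@lebesgue_rV R d]_y (f (x - y)%R * g y).

(* Meaningful for n >= 1 only: conv_pow f 1 = f. *)
Definition conv_pow f (n : nat) : 'rV[R]_d -> \bar R :=
  iter n.-1 (convolution f) f.

Definition compound_poisson f (lambda : R) x : \bar R :=
  (expR (- lambda * L1norm f))%:E *
  \sum_(1 <= n <oo) (lambda ^+ n / n`!%:R)%:E * conv_pow f n x.

Definition D_set x : set 'rV[R]_d :=
  [set z | (enorm z < enorm x - 1)%R /\ (enorm (x - z) < enorm x - 1)%R].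

Definition E_set x : set 'rV[R]_d :=
  [set z | (enorm z < enorm x)%R /\ (enorm (x - z) < enorm x)%R].

(* In \bar R, (+oo)^-1 = 0, so that a / +oo = 0. *)
Definition hg_step (S : 'rV[R]_d -> set 'rV[R]_d) f g x : \bar R :=
  (\int[@lebesgue_rV R d]_(y in S x) (f (x - y)%R * f y * g y)) / f x.

(* Meaningful for n >= 1 only: h_fun f 1 = g_fun f 1 = cst 1. *)
Definition h_fun f (n : nat) : 'rV[R]_d -> \bar R :=
  iter n.-1 (hg_step D_set f) (cst 1).

Definition g_fun f (n : nat) : 'rV[R]_d -> \bar R :=
  iter n.-1 (hg_step E_set f) (cst 1).

End compound_poisson.

(* Main.v *)
From HB Require Import structures.
Require Import Defs.
From mathcomp Require Import all_boot all_order all_algebra.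
From mathcomp Require Import all_classical all_reals all_analysis.
From mathcomp Require Import measurable_realfun.
From mathcomp Require Import ring lra.

(** The estimate compares two ways of counting.  Put C := C1 \/ C2, M := M2 and
    H_n := f h_(n+1), that is H_0 = f and
    H_(n+1)(x) = \int_(D(x)) f(x-y) H_n(y) dy.  Unfolding the recursion, H_n(x)
    is the part of the convolution power f^{*(n+1)}(x) that comes from those
    chains of n + 1 steps ending at x whose later steps, from y to x' say, have
    both |y| and |x'-y| below |x'| - 1; hence f h_n <= f^{*n}, and likewise
    f g_n <= f^{*n}, which are the lower bounds.

    For the upper bounds, let r(x) := max(|x|/2, |x|-1).  Assumption (A) makes f
    comparable with f(x) outside the ball of radius r(x): f z <= C f x as soon as
    |z| >= r(x) ([A_core]).  The radius is chosen so that a point y with |y| < r(x)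
    and |x-y| < r(x) lies in D(x) ([core_D]).  The heart of the proof is
      f^{*(n+1)}(y) <= \sum_(k <= n) binom(n+1, k+1) M^(n-k) H_k(x)  for |y| >= |x|
    ([conv_le_majorant]).  Comparing at two points, and not only at y = x, is what
    makes the induction close: f^{*n} is radial, so y may be taken on the ray
    through x, and in f^{*(n+2)}(y) = \int f(y-z) f^{*(n+1)}(z) dz
    - where |y-z| >= r(x), the first factor is at most C f(x), and the mass of
      f^{*(n+1)} is ||f||^(n+1);
    - where |z| >= r(x), the second factor is at most C times the majorant at x,
      by induction and by the near-monotonicity of H_k along rays ([chain_core]);
    - elsewhere z lies in D(x) and |x-z| <= |y-z|, which reproduces the recursion
      that defines H.
    Adding the three pieces is Pascal's rule ([majorantS]).

    Binomial sums become products of exponential generating functions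
    ([egf_binomial]): summing over n produces the factor e^(M lambda).  For
    |x| < 1 the set D(x) is empty and only the term lambda f(x) survives.  For
    |x| >= 1 the quotients are meaningful because the series of the H_n converges
    ([egf_chain_lty]): on D(x) the factor f(x-y) is bounded by the value of f on
    the unit sphere.  The series of the f g_n lies between that of the f h_n and
    that of the f^{*n}, so the same two inequalities hold with g_n.

    That f^{*n} is radial rests on the invariance of Lebesgue measure under the
    Householder reflection exchanging two vectors of equal norm, which follows
    from translation invariance by a Fubini argument against the unit ball
    ([ge0_integral_isometry]). *)

Import Order.TTheory GRing.Theory Num.Theory.
Import numFieldNormedType.Exports.

Local Open Scope classical_set_scope.
Local Open Scope ring_scope.
Local Open Scope ereal_scope.


Set Implicit Arguments.
Unset Strict Implicit.

(** * Translation invariance of Lebesgue measure on R^n *)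

Lemma lebesgue_measureD (R : realType) (t : R) (A : set R) : measurable A ->
  lebesgue_measure [set s : R | A (s + t)%R] = lebesgue_measure A.
Proof.
move=> mA.
pose phi : measurableTypeR R -> measurableTypeR R := fun s => (s + t)%R.
have mt : measurable_fun setT phi by exact: measurable_funD.
pose phi_mixin := isMeasurableFun.Build _ _ _ _ _ mt.
pose phiM : {mfun _ >-> _} := HB.pack phi phi_mixin.
rewrite [RHS](@lebesgue_measure_unique R (pushforward lebesgue_measure phiM))//.
move=> _ [[a b]] _ <-.
rewrite /= /pushforward.
have -> : phi @^-1` `]a, b] = `](a - t)%R, (b - t)%R]%classic.
  by apply/seteqP; split => s /=; rewrite /phi !in_itv/= ltrBlDr lerBrDr.
rewrite !lebesgue_measure_itv/= !lte_fin ltrD2r; case: ifP => // _.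
by rewrite -!EFinD; congr (_%:E); ring.
Qed.

Section lebesgue_rV_theory.
Context {R : realType}.

Lemma measurable_rV_addr n (x : 'rV[R]_n) :
  measurable_fun setT (fun v : 'rV[R]_n => v + x)%R.
Proof.
apply/measurable_fun_rVP => i; under eq_fun do rewrite mxE.
by apply: measurable_funD => //; exact: measurable_coord.
Qed.

Lemma measurable_rV_sub n :
  measurable_fun setT (fun p : 'rV[R]_n * 'rV[R]_n => p.1 - p.2)%R.
Proof.
apply/measurable_fun_rVP => i; under eq_fun do rewrite !mxE.
by apply: measurable_funB; apply: (measurableT_comp (measurable_coord i)).
Qed.

(** Induction on the dimension: the measure of a set of R^(n+1) is the integral of
    the one-dimensional measures of its sections, and translating the set
    translates both the sections and the variable that indexes them. *)
Lemma lebesgue_rVD n (x : 'rV[R]_n) (A : set 'rV[R]_n) : measurable A ->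
  lebesgue_rV [set v | A (v + x)%R] = lebesgue_rV A.
Proof.
rewrite /lebesgue_rV; elim: n x A => [|n IH] x A mA.
  congr (_ _); apply/seteqP; split => v /=;
    by rewrite (_ : v + x = v)%R//; apply/rowP => -[].
pose x' : 'rV[R]_n := (\row_j x ord0 (lift ord0 j))%R.
pose B := @row_cons R n @^-1` A.
have mB : measurable B.
  by rewrite -[X in measurable X]setTI; exact: measurable_row_cons.
pose phi v := lebesgue_measure (xsection B v).
have mphi : measurable_fun setT phi.
  exact: (measurable_fun_xsection (@lebesgue_measure R)).
transitivity (\int[lebesgue_rV_rec n]_v phi (v + x')%R).
  rewrite /= /lebesgue_cons /pushforward /product_measure1.
  apply: eq_integral => v _ /=.
  rewrite /phi -(@lebesgue_measureD R (x ord0 ord0) (xsection B _)); last first.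
    exact: measurable_xsection.
  congr lebesgue_measure; apply/seteqP; split => t; rewrite /xsection/= !inE/=;
    rewrite /B/=
      (_ : row_cons (v, t) + x = row_cons (v + x', t + x ord0 ord0))%R//;
    apply/rowP => i; rewrite !mxE/=;
    by case: unliftP => [j ->|->]//=; rewrite !mxE.
pose tau v : 'rV[R]_n := (v + x')%R.
have mtau : measurable_fun setT tau by exact: measurable_rV_addr.
transitivity (\int[pushforward (lebesgue_rV_rec n) tau]_v phi v).
  by rewrite (ge0_integral_pushforward mtau)// => v _; exact: measure_ge0.
rewrite /= /lebesgue_cons [in RHS]/pushforward /product_measure1.
apply: eq_measure_integral => C mC _; exact: IH.
Qed.

End lebesgue_rV_theory.

(** * Euclidean norm and Householder reflections *)

Section euclid.
Context {R : realType} {d : nat}.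
Implicit Types (x y z w : 'rV[R]_d).
Local Open Scope ring_scope.

Definition dot x y : R := \sum_(i < d) x ord0 i * y ord0 i.

Lemma dotC x y : dot x y = dot y x.
Proof. by apply: eq_bigr => i _; rewrite mulrC. Qed.

Lemma dotDl x y z : dot (x + y) z = dot x z + dot y z.
Proof. by rewrite -big_split; apply: eq_bigr => i _; rewrite mxE mulrDl. Qed.

Lemma dotZl a x z : dot (a *: x) z = a * dot x z.
Proof. by rewrite /dot mulr_sumr; apply: eq_bigr => i _; rewrite mxE mulrA. Qed.

Lemma dotDr x y z : dot z (x + y) = dot z x + dot z y.
Proof. by rewrite dotC dotDl !(dotC z). Qed.

Lemma dotZr a x z : dot z (a *: x) = a * dot z x.
Proof. by rewrite dotC dotZl (dotC z). Qed.

Lemma dotNl x z : dot (- x) z = - dot x z.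
Proof. by rewrite -scaleN1r dotZl mulN1r. Qed.

Lemma dotNr x z : dot z (- x) = - dot z x.
Proof. by rewrite dotC dotNl (dotC z). Qed.

Definition dotE := (dotDl, dotDr, dotZl, dotZr, dotNl, dotNr).

Lemma dot_ge0 x : 0 <= dot x x.
Proof. by apply: sumr_ge0 => i _; rewrite -expr2 sqr_ge0. Qed.

Lemma dot_eq0 x : dot x x = 0 -> x = 0.
Proof.
move/eqP; rewrite psumr_eq0; last by move=> i _; rewrite -expr2 sqr_ge0.
move=> /allP h; apply/rowP => i; rewrite mxE; apply/eqP.
by rewrite -sqrf_eq0 expr2; apply: h; rewrite mem_index_enum.
Qed.

Lemma enormE x : enorm x = Num.sqrt (dot x x).
Proof. by congr Num.sqrt; apply: eq_bigr => i _; rewrite expr2. Qed.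

Lemma enorm_ge0 x : 0 <= enorm x. Proof. exact: sqrtr_ge0. Qed.

Lemma enorm_sqr x : enorm x ^+ 2 = dot x x.
Proof. by rewrite enormE sqr_sqrtr// dot_ge0. Qed.

Lemma enorm0 : enorm (0 : 'rV[R]_d) = 0.
Proof. by rewrite enormE -(scale0r 0) dotZl mul0r sqrtr0. Qed.

Lemma enorm_eq0 x : enorm x = 0 -> x = 0.
Proof. by move=> h; apply: dot_eq0; rewrite -enorm_sqr h expr0n. Qed.

Lemma enormN x : enorm (- x) = enorm x.
Proof. by rewrite !enormE !dotE opprK. Qed.

Lemma enormB x y : enorm (x - y) = enorm (y - x).
Proof. by rewrite -enormN opprB. Qed.

Lemma enormZ a x : enorm (a *: x) = `|a| * enorm x.
Proof.
by rewrite !enormE !dotE mulrA -expr2 sqrtrM ?sqr_ge0// sqrtr_sqr.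
Qed.

(** Cauchy-Schwarz, by expanding the square of |y| x - |x| y. *)
Lemma dot_le x y : dot x y <= enorm x * enorm y.
Proof.
have [x0|x0] := eqVneq (enorm x) 0.
  by rewrite x0 (enorm_eq0 x0) -(scale0r 0) dotZl !mul0r.
have [y0|y0] := eqVneq (enorm y) 0.
  by rewrite y0 (enorm_eq0 y0) -(scale0r 0) dotZr mul0r mulr0.
have h := dot_ge0 (enorm y *: x - enorm x *: y).
rewrite !dotE (dotC y x) -!enorm_sqr in h.
have p : 0 < enorm x * enorm y by rewrite mulr_gt0// lt0r ?x0 ?y0 enorm_ge0.
have p2 : 0 < 2 * (enorm x * enorm y) by rewrite mulr_gt0.
rewrite -subr_ge0 -(pmulr_rge0 _ p2); apply: le_trans h _.
by rewrite le_eqVlt; apply/orP; left; apply/eqP; ring.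
Qed.

Lemma enormD x y : enorm (x + y) <= enorm x + enorm y.
Proof.
rewrite -(@ler_pXn2r _ 2)// ?nnegrE ?addr_ge0 ?enorm_ge0//.
rewrite sqrrD !enorm_sqr !dotE (dotC y x).
by have := dot_le x y; lra.
Qed.

Lemma enorm_subr_ge x y : enorm x - enorm y <= enorm (x - y).
Proof. by rewrite lerBlDr -{1}(subrK y x) enormD. Qed.

Lemma measurable_enorm : measurable_fun setT (@enorm R d).
Proof.
have ms : measurable_fun setT (fun x : 'rV[R]_d => \sum_(i < d) x ord0 i ^+ 2).
  by apply: measurable_sum => i; apply: measurable_funX; exact: measurable_coord.
have mq : measurable_fun setT (@Num.sqrt R : R -> R).
  by apply: continuous_measurable_fun; exact: sqrt_continuous.
exact: measurableT_comp mq ms.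
Qed.

(** For w = 0 the quotient is 0 and the map is the identity, so that
    [householder (x - y)] maps x to y even when x = y. *)
Definition householder w z : 'rV[R]_d :=
  z - (2 * dot z w / dot w w) *: w.

Lemma householderD w x y :
  householder w (x + y) = householder w x + householder w y.
Proof.
rewrite /householder dotDl mulrDr mulrDl scalerDl opprD.
by rewrite addrACA.
Qed.

Lemma householderN w x : householder w (- x) = - householder w x.
Proof.
by rewrite /householder dotNl mulrN mulNr scaleNr -opprB opprK addrC opprD opprK.
Qed.

Lemma dot_householder w x : dot (householder w x) w = - dot x w.
Proof.
rewrite /householder !dotE.
have [w0|w0] := eqVneq (dot w w) 0; last by field.
have xw : dot x w = 0 by rewrite (dot_eq0 w0) -(scale0r 0) dotZr mul0r.
by rewrite w0 xw !mulr0 subrr oppr0.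
Qed.

Lemma householderK w : involutive (householder w).
Proof.
move=> x; rewrite {1}/householder dot_householder {1}/householder.
by rewrite mulrN mulNr scaleNr opprK subrK.
Qed.

Lemma enorm_householder w x : enorm (householder w x) = enorm x.
Proof.
rewrite !enormE; congr Num.sqrt.
rewrite {2}/householder dotDr dotNr dotZr dot_householder mulrN opprK.
rewrite /householder dotDl dotNl dotZl (dotC w x).
by rewrite subrK.
Qed.

Lemma householder_swap x y : enorm x = enorm y -> householder (x - y) x = y.
Proof.
move=> xy; have xy2 : dot x x = dot y y by rewrite -!enorm_sqr xy.
have [/subr0_eq->|/eqP w0] := pselect (x - y = 0).
  by rewrite /householder subrr scaler0 subr0.
have : dot (x - y) (x - y) != 0.
  by apply/eqP => /dot_eq0 w1; move: w0; rewrite w1 eqxx.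
rewrite /householder => v0.
rewrite (_ : _ / _ = 1) ?scale1r ?subKr//.
rewrite (_ : 2 * dot x (x - y) = dot (x - y) (x - y)) ?divff//.
by rewrite !dotE (dotC y x) -xy2; ring.
Qed.

Lemma measurable_householder w : measurable_fun setT (householder w).
Proof.
apply/measurable_fun_rVP => i; rewrite /householder.
under eq_fun do rewrite !mxE.
apply: measurable_funB; first exact: measurable_coord.
apply: measurable_funM => //; apply: measurable_funM => //.
apply: measurable_funM => //; apply: measurable_sum => j.
by apply: measurable_funM => //; exact: measurable_coord.
Qed.

End euclid.

(** * Balls, sigma-finiteness and invariance under isometries *)

Section lebesgue_rV_invariance.
Context {R : realType} {n : nat}.
Notation V := ('rV[R]_n).
Notation mu := (@lebesgue_rV R n).

Definition cube (a : R) : set V :=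
  [set v | forall i, `[(- a)%R, a]%classic (v ord0 i)].

Lemma measurable_cube a : measurable (cube a).
Proof.
rewrite (_ : cube a = \bigcap_(i in setT)
    ((fun v : V => v ord0 i) @^-1` `[(- a)%R, a]%classic)); last first.
  by apply/seteqP; split=> [v h i _|v h i]; exact: h.
apply: fin_bigcap_measurable => // i _.
by rewrite -[X in measurable X]setTI; exact: measurable_coord.
Qed.

Lemma lebesgue_cube (a : R) : (0 < a)%R -> mu (cube a) = ((2 * a) ^+ n)%:E.
Proof.
move=> a0; rewrite (@lebesgue_rV_box R n (fun=> `[(- a)%R, a]%classic))//.
under eq_bigr do rewrite lebesgue_measure_itv/= lte_fin gtrN// opprK.
by rewrite prodEFin big_const_ord iter_mulr_1 -mulr2n mulr_natl.
Qed.

Lemma lebesgue_rV_sigma_finite : sigma_finite setT mu.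
Proof.
exists (fun k => cube k.+1%:R) => [|k]; last first.
  by rewrite lebesgue_cube ?ltr0n// ltry; split => //; exact: measurable_cube.
apply/esym; rewrite -subTset => v _.
have [k hk] : exists k : nat, (\sum_(i < n) `|v ord0 i| <= k%:R)%R.
  exists (Num.truncn (\sum_(i < n) `|v ord0 i|)).+1.
  exact/ltW/truncnS_gt.
exists k => // i /=; rewrite in_itv/= -ler_norml.
apply: (@le_trans _ _ k%:R%R); last by rewrite ler_nat.
apply: le_trans hk; rewrite (bigD1 i)//= lerDl.
exact: sumr_ge0.
Qed.

HB.instance Definition _ := Measure_isSigmaFinite.Build _ _ _ mu
  lebesgue_rV_sigma_finite.

Definition eball (r : R) : set V := [set v | (enorm v < r)%R].

Lemma measurable_eball r : measurable (eball r).
Proof.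
rewrite (_ : eball r = @enorm R n @^-1` `]-oo, r[%classic).
  by rewrite -[X in measurable X]setTI; apply: measurable_enorm.
by apply/seteqP; split => v /=; rewrite in_itv.
Qed.

(** The ball contains the cube of half-side r / (n+1), since
    n (r / (n+1))^2 < r^2. *)
Lemma lebesgue_eball_gt0 r : (0 < r)%R -> 0 < mu (eball r).
Proof.
move=> r0; pose a : R := (r / n.+1%:R)%R.
have n0 : (0 < n.+1%:R :> R)%R by rewrite ltr0n.
have a0 : (0 < a)%R by rewrite divr_gt0.
apply: (@lt_le_trans _ _ (mu (cube a))).
  by rewrite lebesgue_cube// lte_fin exprn_gt0// mulr_gt0.
apply: le_measure; rewrite ?inE//; [exact: measurable_cube|exact: measurable_eball|].
move=> v h; rewrite /eball/= -(@ltr_pXn2r _ 2)// ?nnegrE ?enorm_ge0// ?ltW//.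
rewrite enorm_sqr; apply: (@le_lt_trans _ _ (\sum_(i < n) a ^+ 2)%R).
  apply: ler_sum => i _; have /= := h i; rewrite in_itv/= -ler_norml => vi.
  by rewrite -expr2 -real_normK ?num_real// ler_pXn2r// nnegrE ltW.
rewrite sumr_const card_ord -mulr_natl /a expr_div_n mulrA ltr_pdivrMr ?exprn_gt0//.
rewrite mulrC ltr_pM2l ?exprn_gt0// -natrX ltr_nat.
by rewrite (@leq_trans n.+1)// -{1}[n.+1]expn1 leq_pexp2l.
Qed.

Lemma lebesgue_eball_lty r : (0 < r)%R -> mu (eball r) < +oo.
Proof.
move=> r0; apply: (@le_lt_trans _ _ (mu (cube r))); last first.
  by rewrite lebesgue_cube// ltry.
apply: le_measure; rewrite ?inE//; [exact: measurable_eball|exact: measurable_cube|].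
move=> v /= vr i; rewrite /= in_itv/= -ler_norml.
apply: le_trans (ltW vr); rewrite -(@ler_pXn2r _ 2)// ?nnegrE ?enorm_ge0//.
rewrite enorm_sqr /dot (bigD1 i)//= real_normK ?num_real// expr2 lerDl.
by apply: sumr_ge0 => j _; rewrite -expr2 sqr_ge0.
Qed.

Lemma ge0_integral_rV_addr (g : V -> \bar R) (x : V) :
  measurable_fun setT g -> (forall v, 0 <= g v) ->
  \int[mu]_v g (v + x)%R = \int[mu]_v g v.
Proof.
move=> mg g0.
have mtau := measurable_rV_addr x.
transitivity (\int[pushforward mu (fun v => v + x)%R]_v g v).
  by rewrite (ge0_integral_pushforward mtau).
apply: eq_measure_integral => C mC _; exact: lebesgue_rVD.
Qed.

Lemma ge0_integral_rV_subr (g : V -> \bar R) (x : V) :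
  measurable_fun setT g -> (forall v, 0 <= g v) ->
  \int[mu]_v g (v - x)%R = \int[mu]_v g v.
Proof. exact: ge0_integral_rV_addr. Qed.

Lemma measurable_rV_add :
  measurable_fun setT (fun p : V * V => p.1 + p.2)%R.
Proof.
apply/measurable_fun_rVP => i; under eq_fun do rewrite !mxE.
by apply: measurable_funD; apply: (measurableT_comp (measurable_coord i)).
Qed.

(** Let B be the unit ball and b its indicator.  Integrating
    b(x) g(y + T x) first in y gives mu(B) \int g, by translation invariance.
    Integrating it first in x, after the shift x := x' - T y, turns the integrand
    into b(T x' - y) g(T x'), whose integral is mu(B) \int (g o T).  As
    0 < mu(B) < +oo, this factor cancels.  No determinant is involved: T only has
    to be an additive, norm-preserving involution. *)
Lemma ge0_integral_isometry (T : V -> V) (g : V -> \bar R) :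
  measurable_fun setT T -> {morph T : x y / (x + y)%R} -> involutive T ->
  (forall x, enorm (T x) = enorm x) ->
  measurable_fun setT g -> (forall v, 0 <= g v) ->
  \int[mu]_v g (T v) = \int[mu]_v g v.
Proof.
move=> mT TD TK TN mg g0.
pose b (v : V) : \bar R := (\1_(eball 1) v)%:E.
have mb : measurable_fun setT b.
  by apply/measurable_EFinP/measurable_indic; exact: measurable_eball.
have b0 v : 0 <= b v by rewrite lee_fin.
have mgT : measurable_fun setT (g \o T) by exact: measurableT_comp.
pose beta := mu (eball 1).
have bP v w : enorm v = enorm w -> b v = b w.
  by move=> vw; rewrite /b !indicE; congr (_%:R)%:E; congr nat_of_bool;
    apply/idP/idP; rewrite !inE /eball/= vw.
have mbT y : measurable_fun setT (fun x => b (T x - y)%R).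
  exact: measurableT_comp mb (measurableT_comp (measurable_rV_addr _) mT).
have intb : \int[mu]_v b v = beta.
  by rewrite integral_indic// ?setIT//; exact: measurable_eball.
have [beta0 betay] : 0 < beta /\ beta < +oo.
  by split; [exact: lebesgue_eball_gt0|exact: lebesgue_eball_lty].
pose F (p : V * V) := b p.1 * g (p.2 + T p.1)%R.
have mF : measurable_fun setT F.
  apply: emeasurable_funM; first exact: measurableT_comp.
  apply: (measurableT_comp mg).
  apply: (measurableT_comp measurable_rV_add
    (g := fun p : V * V => (p.2, T p.1))).
  by apply: measurable_fun_pair => //; exact: measurableT_comp.
have F0 p : 0 <= F p by rewrite mule_ge0.
have e1 : \int[mu]_x \int[mu]_y F (x, y) = beta * \int[mu]_v g v.
  rewrite -intb -ge0_integralZr//; last exact: integral_ge0.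
  apply: eq_integral => x _; rewrite /F/= ge0_integralZl//.
    by rewrite ge0_integral_rV_addr.
  exact: measurableT_comp mg (measurable_rV_addr _).
have e2 : \int[mu]_y \int[mu]_x F (x, y) = beta * \int[mu]_v g (T v).
  transitivity (\int[mu]_y \int[mu]_x (b (T x - y)%R * g (T x))).
    apply: eq_integral => y _.
    rewrite -(@ge0_integral_rV_addr (fun x => b (T x - y)%R * g (T x)) (T y)).
    - apply: eq_integral => x _; rewrite TD TK addrK /F/= addrC.
      by rewrite (bP _ x (TN x)).
    - exact: emeasurable_funM (mbT y) mgT.
    - by move=> v; rewrite mule_ge0.
  pose G (p : V * V) := b (T p.2 - p.1)%R * g (T p.2).
  have mG : measurable_fun setT G.
    apply: emeasurable_funM; last exact: measurableT_comp mgT _.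
    apply: (measurableT_comp mb).
    apply: (measurableT_comp (@measurable_rV_sub R n)
      (g := fun p : V * V => (T p.2, p.1))).
    by apply: measurable_fun_pair => //; exact: measurableT_comp.
  rewrite [LHS](fubini_tonelli G)//; last by move=> p; rewrite mule_ge0.
  rewrite -ge0_integralZl//; last exact: ltW.
  apply: eq_integral => x _; rewrite /G/= ge0_integralZr//; last first.
    apply: (measurableT_comp mb); apply: (measurableT_comp
      (@measurable_rV_sub R n) (g := fun y : V => (T x, y))).
    by apply: measurable_fun_pair.
  congr (_ * _); rewrite -intb -(ge0_integral_rV_subr (T x) mb b0).
  by apply: eq_integral => y _; apply: bP; rewrite enormB.
have E : beta * \int[mu]_v g (T v) = beta * \int[mu]_v g v.
  by rewrite -e1 -e2; apply/esym; exact: (fubini_tonelli F).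
have fb : beta \is a fin_num by rewrite ge0_fin_numE// ltW.
have mulI a c : beta * a = beta * c -> a <= c.
  by move=> ac; rewrite -(lee_pmul2l fb beta0) ac.
by apply/eqP; rewrite eq_le !mulI.
Qed.

End lebesgue_rV_invariance.

(** * Iterated convolutions restricted to moving domains *)

Section convolution_theory.
Context {R : realType} {d : nat}.
Notation V := ('rV[R]_d).
Notation mu := (@lebesgue_rV R d).
Implicit Types (f g : V -> \bar R) (S : V -> set V).

(** Convolution with the inner variable restricted to S x: taking S x to be the
    whole space gives the usual convolution, and S = D_set, S = E_set give the
    recursions satisfied by f h and f g. *)
Definition rconv S f g (x : V) : \bar R :=
  \int[mu]_(y in S x) (f (x - y)%R * g y).

Definition graph S : set (V * V) := [set p | S p.1 p.2].

(** Moving the domain into the integrand lets measurability in x, monotonicity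
    and linearity come from Fubini-Tonelli and from integrals over the whole
    space. *)
Definition rconv_kernel S f g (p : V * V) : \bar R :=
  f (p.1 - p.2)%R * g p.2 * (\1_(graph S) p)%:E.

Lemma rconvE S f g x : rconv S f g x = \int[mu]_y rconv_kernel S f g (x, y).
Proof.
rewrite /rconv integral_mkcond epatch_indic; apply: eq_integral => y _ /=.
by rewrite /rconv_kernel/=; congr (_ * _); rewrite !indicE; congr (_%:R)%:E;
  congr nat_of_bool; apply/idP/idP; rewrite !inE.
Qed.

Lemma measurable_rconv_kernel S f g : measurable (graph S) ->
  measurable_fun setT f -> measurable_fun setT g ->
  measurable_fun setT (rconv_kernel S f g).
Proof.
move=> mS mf mg; apply: emeasurable_funM; last first.
  by apply/measurable_EFinP/measurable_indic.
apply: emeasurable_funM; first exact: measurableT_comp mf (@measurable_rV_sub _ _).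
exact: measurableT_comp.
Qed.

Lemma rconv_kernel_ge0 S f g p : (forall x, 0 <= f x) -> (forall x, 0 <= g x) ->
  0 <= rconv_kernel S f g p.
Proof. by move=> f0 g0; rewrite !mule_ge0// lee_fin. Qed.

Lemma rconv_ge0 S f g x : (forall x, 0 <= f x) -> (forall x, 0 <= g x) ->
  0 <= rconv S f g x.
Proof. by move=> f0 g0; apply: integral_ge0 => y _; rewrite mule_ge0. Qed.

Lemma measurable_rconv S f g : measurable (graph S) ->
  measurable_fun setT f -> measurable_fun setT g ->
  (forall x, 0 <= f x) -> (forall x, 0 <= g x) ->
  measurable_fun setT (rconv S f g).
Proof.
move=> mS mf mg f0 g0.
rewrite [X in measurable_fun _ X](_ : _ = fubini_F mu (rconv_kernel S f g)).
  apply: measurable_fun_fubini_tonelli_F.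
    exact: measurable_rconv_kernel.
  by move=> p; exact: rconv_kernel_ge0.
by apply/funext => x; rewrite rconvE.
Qed.

Lemma measurable_kernel_section (K : V * V -> \bar R) x :
  measurable_fun setT K -> measurable_fun setT (fun y => K (x, y)).
Proof. by move=> mK; exact: measurableT_comp. Qed.

Lemma rconv_le S S' f g g' x : measurable (graph S) -> measurable (graph S') ->
  measurable_fun setT f -> measurable_fun setT g -> measurable_fun setT g' ->
  (forall x, 0 <= f x) -> (forall x, 0 <= g x) ->
  S x `<=` S' x -> (forall y, g y <= g' y) ->
  rconv S f g x <= rconv S' f g' x.
Proof.
move=> mS mS' mf mg mg' f0 g0 SS' gg'; rewrite !rconvE.
apply: ge0_le_integral => //.
- by move=> y _; exact: rconv_kernel_ge0.
- by apply: measurable_kernel_section; exact: measurable_rconv_kernel.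
- by apply: measurable_kernel_section; exact: measurable_rconv_kernel.
move=> y _; rewrite /rconv_kernel/=; apply: lee_pmul.
- by rewrite mule_ge0.
- by rewrite lee_fin.
- by rewrite lee_wpmul2l.
rewrite lee_fin !indicE ler_nat; case: (boolP (_ \in graph S)) => //.
by rewrite inE /graph/= => /SS' h; rewrite (_ : _ \in _)//; rewrite inE.
Qed.

Lemma rconv_sum S f n (c : 'I_n -> R) (g : 'I_n -> V -> \bar R) x :
  measurable (graph S) -> measurable_fun setT f ->
  (forall k, measurable_fun setT (g k)) ->
  (forall x, 0 <= f x) -> (forall k x, 0 <= g k x) -> (forall k, 0 <= c k)%R ->
  rconv S f (fun y => \sum_(k < n) (c k)%:E * g k y) x =
  \sum_(k < n) (c k)%:E * rconv S f (g k) x.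
Proof.
move=> mS mf mg f0 g0 c0.
have mK k : measurable_fun setT (fun y => rconv_kernel S f (g k) (x, y)).
  by apply: measurable_kernel_section; exact: measurable_rconv_kernel.
have K0 k y : 0 <= rconv_kernel S f (g k) (x, y) by exact: rconv_kernel_ge0.
transitivity (\int[mu]_y \sum_(k < n) (c k)%:E * rconv_kernel S f (g k) (x, y)).
  rewrite rconvE; apply: eq_integral => y _; rewrite /rconv_kernel/=.
  rewrite ge0_sume_distrr; last by move=> k _; rewrite mule_ge0// lee_fin.
  rewrite ge0_sume_distrl; last by move=> k _; rewrite !mule_ge0// lee_fin.
  by apply: eq_bigr => k _; rewrite muleCA -!muleA.
rewrite ge0_integral_sum//.
- by apply: eq_bigr => k _; rewrite ge0_integralZl// ?lee_fin// rconvE.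
- by move=> k; exact: measurable_funeM.
- by move=> k y _; rewrite mule_ge0// lee_fin.
Qed.

Definition full (_ : V) : set V := setT.

Lemma measurable_graph_full : measurable (graph full).
Proof. by rewrite (_ : graph _ = setT)//; apply/seteqP; split. Qed.

Lemma measurable_graph_lt (u v : V * V -> R) : measurable_fun setT u ->
  measurable_fun setT v -> measurable [set p | (u p < v p)%R].
Proof.
move=> mu' mv.
rewrite -[X in measurable X]setTI.
exact: (measurable_fun_ltr mu' mv measurableT (Y := [set true])).
Qed.

Lemma measurable_graph_ball (a : V * V -> R) : measurable_fun setT a ->
  measurable (graph (fun x =>
    [set z | (enorm z < a (x, z))%R /\ (enorm (x - z) < a (x, z))%R])).
Proof.
move=> ma.
rewrite (_ : graph _ = [set p | (enorm p.2 < a p)%R] `&`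
  [set p | (enorm (p.1 - p.2) < a p)%R]).
  apply: measurableI; apply: measurable_graph_lt => //.
    exact: measurableT_comp (@measurable_enorm _ _) _.
  exact: measurableT_comp (@measurable_enorm _ _) (@measurable_rV_sub _ _).
by apply/seteqP; split => -[x y].
Qed.

Lemma measurable_graph_D : measurable (graph (@D_set R d)).
Proof.
apply: (measurable_graph_ball (a := fun p => (enorm p.1 - 1)%R)).
apply: measurable_funB => //; exact: measurableT_comp (@measurable_enorm _ _) _.
Qed.

Lemma measurable_graph_E : measurable (graph (@E_set R d)).
Proof.
apply: (measurable_graph_ball (a := fun p => enorm p.1)).
exact: measurableT_comp (@measurable_enorm _ _) _.
Qed.

(** The index is shifted by one: [chain S f n] has n + 1 factors f.  On the whole
    space it is the (n+1)-fold convolution power of f. *)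
Definition chain S f n : V -> \bar R := iter n (rconv S f) f.

Lemma chainS S f n x : chain S f n.+1 x = rconv S f (chain S f n) x.
Proof. by []. Qed.

Lemma chain_ge0 S f n x : (forall x, 0 <= f x) -> 0 <= chain S f n x.
Proof.
move=> f0; elim: n x => [|n IH] x //=; exact: rconv_ge0.
Qed.

Lemma measurable_chain S f n : measurable (graph S) ->
  measurable_fun setT f -> (forall x, 0 <= f x) ->
  measurable_fun setT (chain S f n).
Proof.
move=> mS mf f0; elim: n => //= n IH.
by apply: measurable_rconv => // x; exact: chain_ge0.
Qed.

Lemma chain_le_full S f n x : measurable (graph S) ->
  measurable_fun setT f -> (forall x, 0 <= f x) ->
  chain S f n x <= chain full f n x.
Proof.
move=> mS mf f0; elim: n x => [|n IH] x; first exact: lexx.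
apply: rconv_le => //; [exact: measurable_graph_full|exact: measurable_chain..| |].
  by apply: measurable_chain => //; exact: measurable_graph_full.
by move=> y; exact: chain_ge0.
Qed.

Definition radial g := forall x y, enorm x = enorm y -> g x = g y.

(** If |x| = |y|, the reflection exchanging x and y is a measure-preserving
    change of variable that leaves both factors unchanged. *)
Lemma radial_rconv f g :
  measurable_fun setT f -> measurable_fun setT g ->
  (forall x, 0 <= f x) -> (forall x, 0 <= g x) ->
  radial f -> radial g -> radial (rconv full f g).
Proof.
move=> mf mg f0 g0 rf rg x y xy.
pose T := householder (x - y).
have mT : measurable_fun setT T by exact: measurable_householder.
have K0 S p : 0 <= rconv_kernel S f g p by exact: rconv_kernel_ge0.
have mK := measurable_rconv_kernel measurable_graph_full mf mg.
rewrite !rconvE -(@ge0_integral_isometry _ _ T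
  (fun z => rconv_kernel full f g (y, z)))//.
- apply: eq_integral => z _; rewrite /rconv_kernel /=.
  rewrite -(rg z (T z)) ?enorm_householder//.
  have -> : (y - T z = T (x - z))%R.
    by rewrite /T householderD householderN householder_swap.
  rewrite -(rf (x - z) (T (x - z)))%R ?enorm_householder//.
- exact: householderD.
- exact: householderK.
- exact: enorm_householder.
- exact: measurable_kernel_section.
Qed.

Lemma radial_chain f n : measurable_fun setT f -> (forall x, 0 <= f x) ->
  radial f -> radial (chain full f n).
Proof.
move=> mf f0 rf; elim: n => //= n IH; apply: radial_rconv => //.
  by apply: measurable_chain => //; exact: measurable_graph_full.
by move=> x; exact: chain_ge0.
Qed.

Lemma integral_rconv f g :
  measurable_fun setT f -> measurable_fun setT g ->
  (forall x, 0 <= f x) -> (forall x, 0 <= g x) ->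
  \int[mu]_x rconv full f g x = (\int[mu]_x f x) * \int[mu]_x g x.
Proof.
move=> mf mg f0 g0.
pose G (p : V * V) := f (p.1 - p.2)%R * g p.2.
have mG : measurable_fun setT G.
  apply: emeasurable_funM; first exact: measurableT_comp mf (@measurable_rV_sub _ _).
  exact: measurableT_comp.
rewrite [LHS](fubini_tonelli G)//; last by move=> p; rewrite mule_ge0.
rewrite -ge0_integralZl//; last exact: integral_ge0.
apply: eq_integral => y _; rewrite /G/= ge0_integralZr//.
  by rewrite ge0_integral_rV_subr.
exact: measurableT_comp mf (measurable_rV_addr _).
Qed.

Lemma integral_chain f n :
  measurable_fun setT f -> (forall x, 0 <= f x) ->
  \int[mu]_x chain full f n x = (\int[mu]_x f x) ^+ n.+1.
Proof.
move=> mf f0; elim: n => [|n IH]; first by [].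
rewrite expeS [LHS](integral_rconv (g := chain full f n))//.
- by rewrite IH.
- by apply: measurable_chain => //; exact: measurable_graph_full.
- by move=> x; exact: chain_ge0.
Qed.

(** Clears the denominators of h and g.  At a point other than 0 the value of f is
    a positive real and the division cancels; at 0, where f may be infinite, both
    sides vanish for n > 0 because the domain of integration is empty. *)
Lemma chain_hg S f n x : S 0%R = set0 -> (forall x, 0 <= f x) ->
  (forall x, x != 0%R -> 0 < f x < +oo) ->
  chain S f n x = f x * iter n (hg_step S f) (cst 1) x.
Proof.
move=> S0 f0 ffin; elim: n x => [|n IH] x; first by rewrite /= mule1.
have -> : chain S f n.+1 x =
    \int[mu]_(y in S x) (f (x - y)%R * f y * iter n (hg_step S f) (cst 1) y).
  by apply: eq_integral => y _; rewrite -muleA -IH.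
rewrite iterS {2}/hg_step.
have [->|/ffin /andP[]] := eqVneq x 0%R.
  by rewrite S0 !integral_set0 mul0e mule0.
case: (f x) => [r|//|//]; rewrite lte_fin => r0 _.
rewrite inver gt_eqF// muleCA -EFinM mulfV ?gt_eqF//.
by rewrite mule1.
Qed.

End convolution_theory.

(** * Pointwise bounds under assumption (A) *)

Section estimates.
Context {R : realType} {d : nat}.
Notation V := ('rV[R]_d).
Notation mu := (@lebesgue_rV R d).
Variables (f : V -> \bar R) (C1 C2 : R).
Hypothesis fA : assumption_A f C1 C2.
Implicit Types (x y z : V).

Notation C := (Num.max C1 C2).
Notation N := (L1norm f).
Notation M := (Num.max C1 C2 * L1norm f)%R.

Lemma A_ge0 x : 0 <= f x. Proof. exact/ltW/(A_pos fA). Qed.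

Lemma A_measurable : measurable_fun setT f.
Proof. by have [intf _ _] := A_density fA; exact: measurable_int intf. Qed.

Hint Resolve A_ge0 A_measurable : core.

Lemma A_integral : \int[mu]_x f x = N%:E.
Proof.
have [intf _ _] := A_density fA.
have e : \int[mu]_x `|f x| = \int[mu]_x f x.
  by apply: eq_integral => x _; rewrite gee0_abs.
have /integrableP[_] := intf; rewrite e => flty.
rewrite /L1norm Lnorm1 e fineK// ge0_fin_numE//.
exact: integral_ge0.
Qed.

Lemma L1norm_ge0 : (0 <= N)%R.
Proof. by rewrite -lee_fin -A_integral integral_ge0. Qed.

Lemma A_decreasing x y : (enorm y <= enorm x)%R -> f x <= f y.
Proof.
have [F [Fmono Ff]] := A_radial fA.
by move=> yx; rewrite !Ff; apply: Fmono => //; exact: enorm_ge0.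
Qed.

Lemma A_isotropic : radial f.
Proof. by have [F [_ Ff]] := A_radial fA => x y xy; rewrite !Ff xy. Qed.

(** An infinite value at x would, by monotonicity, make f infinite on a ball of
    positive measure. *)
Lemma A_finite x : x != 0%R -> f x < +oo.
Proof.
move=> x0; rewrite ltey; apply/eqP => fx.
have nx : (0 < enorm x)%R.
  by rewrite lt0r enorm_ge0 andbT; apply: contra x0 => /eqP/enorm_eq0/eqP.
have [intf _ _] := A_density fA.
have [B [mB B0 sB]] := integrable_ae measurableT intf.
have : mu (eball (enorm x)) <= mu B.
  apply: le_measure; rewrite ?inE//; first exact: measurable_eball.
  move=> v /= vx; apply: sB => /= /(_ I).
  have := A_decreasing (ltW vx); rewrite fx leye_eq => /eqP ->.
  by [].
by rewrite B0 leNgt lebesgue_eball_gt0.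
Qed.

Lemma maxC_ge1 : (1 <= C)%R.
Proof. by rewrite le_max (A_C1_ge1 fA). Qed.

Lemma maxC_ge0 : (0 <= C)%R. Proof. exact: le_trans maxC_ge1. Qed.

Lemma M2_ge0 : (0 <= M)%R. Proof. by rewrite mulr_ge0 ?maxC_ge0 ?L1norm_ge0. Qed.

Lemma le_maxC (a : \bar R) : 0 <= a -> a <= C%:E * a.
Proof.
by move=> a0; rewrite -[X in X <= _]mul1e lee_wpmul2r// lee_fin maxC_ge1.
Qed.

Lemma A_step x y : (1 <= enorm x)%R -> (enorm y <= enorm x + 1)%R ->
  f x <= C%:E * f y.
Proof.
move=> x1 yx; have [xy|yx'] := leP (enorm x) (enorm y).
  apply: (le_trans (A_C1 fA x1 xy yx)).
  by rewrite lee_wpmul2r// lee_fin le_max lexx.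
exact: le_trans (A_decreasing (ltW yx')) (le_maxC _).
Qed.

(** |x|/2 serves (c) when |x| <= 2 and |x| - 1 serves (b) when |x| > 2. *)
Definition core_radius x : R := Num.max (enorm x / 2)%R (enorm x - 1)%R.

Lemma A_core x z : (core_radius x <= enorm z)%R -> f z <= C%:E * f x.
Proof.
rewrite /core_radius ge_max => /andP[h1 h2].
have [x2|x2] := leP (enorm x) 2%R.
  pose y := (2^-1 *: x)%R.
  have yE : enorm y = (enorm x / 2)%R.
    by rewrite enormZ ger0_norm ?invr_ge0// mulrC.
  apply: (@le_trans _ _ (f y)); first by apply: A_decreasing; rewrite yE.
  have y1 : (enorm y <= 1)%R by rewrite yE; lra.
  apply: (le_trans (A_C2 fA y1)).
  rewrite scalerA mulfV// scale1r lee_wpmul2r// lee_fin.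
  by rewrite le_max lexx orbT.
by apply: A_step; lra.
Qed.

Lemma core_radius_le x : (enorm x - 1 <= core_radius x)%R.
Proof. by rewrite le_max lexx orbT. Qed.

(** By the triangle inequality the two hypotheses exclude that the radius is
    |x|/2, so it is |x| - 1. *)
Lemma core_D x z : (enorm z < core_radius x)%R ->
  (enorm (x - z) < core_radius x)%R -> D_set x z.
Proof.
rewrite /core_radius; set m := Num.max _ _ => zm xzm.
have h := enorm_subr_ge x (x - z).
rewrite subKr in h.
have m2 : (m = enorm x - 1)%R.
  rewrite /m; apply/max_idPr; move: zm xzm.
  by rewrite /m maxEle; case: ifP => //; lra.
by split; rewrite -m2.
Qed.

Notation H := (chain (@D_set R d) f).

Lemma H_ge0 n x : 0 <= H n x. Proof. exact: chain_ge0. Qed.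

Lemma H_measurable n : measurable_fun setT (H n).
Proof. by apply: measurable_chain => //; exact: measurable_graph_D. Qed.

Hint Resolve H_ge0 H_measurable : core.

(** Shortening x by at most 1 along its ray costs a factor C.  In the recursion
    for y = s x the point z runs over D(y), where |y-z| > 1; moving y to x changes
    this norm by at most 1, so (b) bounds f(y-z) by C f(x-z), and D(y) is contained
    in D(x).  The factor C is lost only once, since the inner factor H_n(z) is the
    same on both sides. *)
Lemma chain_core n x (s : R) : (0 <= s <= 1)%R ->
  (core_radius x <= enorm (s *: x))%R ->
  H n (s *: x)%R <= C%:E * H n x.
Proof.
move=> /andP[s0 s1] rs; case: n => [|n]; first exact: A_core.
set y := (s *: x)%R.
have xy : (enorm (x - y) = enorm x - enorm y)%R.
  rewrite /y -{1}(scale1r x) -scalerBl !enormZ !ger0_norm ?subr_ge0//.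
  by rewrite mulrBl mul1r.
have yx : (0 <= enorm x - enorm y)%R by rewrite -xy enorm_ge0.
have xy1 : (enorm x - enorm y <= 1)%R.
  by have := core_radius_le x; rewrite -/y in rs *; lra.
rewrite !chainS !rconvE -ge0_integralZl//; last 3 first.
- apply: measurable_kernel_section; apply: measurable_rconv_kernel => //.
  exact: measurable_graph_D.
- by move=> z _; exact: rconv_kernel_ge0.
- by rewrite lee_fin maxC_ge0.
apply: ge0_le_integral => //.
- by move=> z _; exact: rconv_kernel_ge0.
- apply: measurable_kernel_section; apply: measurable_rconv_kernel => //.
  exact: measurable_graph_D.
- apply: measurable_funeM; apply: measurable_kernel_section.
  by apply: measurable_rconv_kernel => //; exact: measurable_graph_D.
move=> z _; rewrite /rconv_kernel/= !indicE.
have K0 : 0 <=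
    C%:E * (f (x - z)%R * H n z * ((x, z) \in graph (@D_set R d))%:R%:E).
  by rewrite !mule_ge0// lee_fin ?maxC_ge0.
case: (boolP ((y, z) \in _)) => [|_]; last by rewrite mule0.
rewrite inE => -[/= zy yzy].
have xz : (enorm (x - z) <= enorm (y - z) + (enorm x - enorm y))%R.
  rewrite -xy (_ : x - z = (y - z) + (x - y))%R ?enormD//.
  by rewrite [RHS]addrC addrA subrK.
rewrite mem_set; last by split => /=; lra.
rewrite !mule1 muleA lee_wpmul2r//; apply: A_step; last lra.
by have := enorm_subr_ge y z; lra.
Qed.

(** With the shifted indices, this is f(x) times the sum over 1 <= k <= n + 1 of
    binom(n+1, k) M^(n+1-k) h_k(x). *)
Definition majorant n x : \bar R :=
  \sum_(k < n.+1) ('C(n.+1, k.+1)%:R * M ^+ (n - k))%:E * H k x.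

Lemma coef_ge0 n k : 0 <= ('C(n.+1, k.+1)%:R * M ^+ (n - k))%:E.
Proof. by rewrite lee_fin mulr_ge0// exprn_ge0// M2_ge0. Qed.

Lemma majorant_ge0 n x : 0 <= majorant n x.
Proof. by apply: sume_ge0 => k _; rewrite mule_ge0 ?coef_ge0. Qed.

Lemma measurable_majorant n : measurable_fun setT (majorant n).
Proof. by apply: emeasurable_sum => k; exact: measurable_funeM. Qed.

Lemma majorant_core n x (s : R) : (0 <= s <= 1)%R ->
  (core_radius x <= enorm (s *: x))%R ->
  majorant n (s *: x)%R <= C%:E * majorant n x.
Proof.
move=> s01 rs; rewrite /majorant ge0_sume_distrr; last first.
  by move=> k _; rewrite mule_ge0 ?coef_ge0.
by apply: lee_sum => k _; rewrite muleCA lee_wpmul2l ?coef_ge0// chain_core.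
Qed.

Lemma majorantS n x : majorant n.+1 x =
  (M ^+ n.+1)%:E * f x + M%:E * majorant n x +
  rconv (@D_set R d) f (majorant n) x.
Proof.
rewrite rconv_sum//; last 2 first.
- exact: measurable_graph_D.
- by move=> k; rewrite -lee_fin coef_ge0.
rewrite {1}/majorant.
under eq_bigr => k _.
  rewrite binS natrD mulrDl EFinD ge0_muleDl; last 2 first.
  - by rewrite lee_fin mulr_ge0// exprn_ge0// M2_ge0.
  - by rewrite lee_fin mulr_ge0// exprn_ge0// M2_ge0.
  over.
rewrite big_split/= big_ord_recr/= bin_small// mul0r mul0e adde0.
rewrite [X in _ + X]big_ord_recl/= bin0 mul1r subn0 addeCA -addeA.
congr (_ + (_ + _)).
rewrite ge0_sume_distrr; last by move=> k _; rewrite mule_ge0 ?coef_ge0.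
apply: eq_bigr => k _; rewrite muleA -EFinM mulrCA -exprS -subSn//.
by rewrite -ltnS.
Qed.

(** Along the ray through x, the distance to z increases once past the
    projection of z, which is no longer than x. *)
Lemma enorm_dilate x z (t : R) : (1 <= t)%R -> (enorm z <= enorm x)%R ->
  (enorm (x - z) <= enorm (t *: x - z))%R.
Proof.
move=> t1 zx; rewrite -(@ler_pXn2r _ 2)// ?nnegrE ?enorm_ge0//.
rewrite !enorm_sqr !dotE (dotC z x) -!enorm_sqr.
have h : (dot x z <= enorm x ^+ 2)%R.
  by apply: (le_trans (dot_le x z)); rewrite expr2 ler_wpM2l// enorm_ge0.
rewrite -subr_ge0 [leRHS](_ : _ = (t - 1) * ((t - 1) * enorm x ^+ 2 +
  2 * (enorm x ^+ 2 - dot x z)))%R; last by ring.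
have t0 : (0 <= t - 1)%R by rewrite subr_ge0.
have h0 : (0 <= enorm x ^+ 2 - dot x z)%R by rewrite subr_ge0.
by rewrite mulr_ge0// addr_ge0// mulr_ge0// sqr_ge0.
Qed.

Lemma core_radius_le_enorm x : (core_radius x <= enorm x)%R.
Proof.
have := enorm_ge0 x; rewrite /core_radius ge_max => x0; apply/andP; split; [lra|].
lra.
Qed.

Lemma core_radius0 : core_radius 0%R = 0%R.
Proof. by rewrite /core_radius enorm0 mul0r; apply/max_idPl; lra. Qed.

Notation Fstar := (chain (@full R d) f).

Lemma Fstar_ge0 n x : 0 <= Fstar n x. Proof. exact: chain_ge0. Qed.

Lemma Fstar_measurable n : measurable_fun setT (Fstar n).
Proof. by apply: measurable_chain => //; exact: measurable_graph_full. Qed.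

Lemma Fstar_radial n : radial (Fstar n).
Proof. apply: radial_chain => //; exact: A_isotropic. Qed.

Hint Resolve Fstar_ge0 Fstar_measurable : core.

Lemma enorm_rescale x y : x != 0%R ->
  enorm ((enorm y / enorm x)%R *: x) = enorm y.
Proof.
move=> x0; rewrite enormZ ger0_norm ?divr_ge0 ?enorm_ge0// divfK//.
by apply: contra x0 => /eqP/enorm_eq0/eqP.
Qed.

(** Extends the induction hypothesis from |z| >= |x| to |z| >= r(x): for shorter z,
    move z to the ray through x, use the hypothesis there with both points equal,
    and compare the majorants along the ray. *)
Lemma conv_core n x z :
  (forall x y, (enorm x <= enorm y)%R -> Fstar n y <= majorant n x) ->
  (core_radius x <= enorm z)%R -> Fstar n z <= C%:E * majorant n x.
Proof.
move=> IH xz; have [xz'|zx] := leP (enorm x) (enorm z).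
  exact: le_trans (IH _ _ xz') (le_maxC (majorant_ge0 _ _)).
have x0 : (0 < enorm x)%R by rewrite (le_lt_trans _ zx)// enorm_ge0.
have xn0 : x != 0%R by apply: contraTneq x0 => ->; rewrite enorm0 ltxx.
have z'z := enorm_rescale z xn0.
rewrite (Fstar_radial n (esym z'z)); apply: (le_trans (IH _ _ (lexx _))).
apply: majorant_core; last by rewrite z'z.
by rewrite divr_ge0 ?enorm_ge0//= ler_pdivrMr// mul1r ltW.
Qed.

(** K1, K2 and K3 below dominate the integrand on the three regions |y-z| >= r(x),
    |z| >= r(x) and D(x).  Since each is nonnegative, bounding by their sum
    everywhere replaces a partition of the domain of integration. *)
Lemma conv_le_majorant n x y : (enorm x <= enorm y)%R ->
  Fstar n y <= majorant n x.
Proof.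
elim: n x y => [|n IH] x y xy.
  by rewrite /majorant big_ord1 binn mul1r expr0 mul1e; exact: A_decreasing.
(* y' is y moved to the ray through x; for x = 0 the radius r(x) is 0 and the
   condition is void, whatever the direction of y. *)
have [y' yy' hy'] : exists2 y' : V, enorm y' = enorm y & forall z,
    (enorm z < core_radius x)%R -> (enorm (x - z) <= enorm (y' - z))%R.
  have [x0|x0] := eqVneq x 0%R.
    by exists y => // z; rewrite x0 core_radius0 ltNge enorm_ge0.
  exists ((enorm y / enorm x)%R *: x); first exact: enorm_rescale.
  move=> z zx; apply: enorm_dilate; last first.
    exact: le_trans (ltW zx) (core_radius_le_enorm x).
  rewrite ler_pdivlMr ?mul1r// lt0r enorm_ge0 andbT.
  by apply: contra x0 => /eqP/enorm_eq0/eqP.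
rewrite (Fstar_radial n.+1 (esym yy')) majorantS chainS !rconvE.
set m := majorant n x.
have m0 : 0 <= m by exact: majorant_ge0.
pose K1 z := C%:E * f x * Fstar n z.
pose K2 z := f (z - y')%R * (C%:E * m).
pose K3 z := rconv_kernel (@D_set R d) f (majorant n) (x, z).
have mgD := @measurable_graph_D R d.
have mK1 : measurable_fun setT K1 by apply: emeasurable_funM.
have mK2 : measurable_fun setT K2.
  apply: emeasurable_funM => //.
  exact: measurableT_comp A_measurable (measurable_rV_addr _).
have mm := measurable_majorant n.
have mK3 : measurable_fun setT K3.
  by apply: measurable_kernel_section; exact: measurable_rconv_kernel.
have K10 z : 0 <= K1 z by rewrite !mule_ge0// lee_fin maxC_ge0.
have K20 z : 0 <= K2 z by rewrite !mule_ge0// lee_fin maxC_ge0.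
have K30 z : 0 <= K3 z by apply: rconv_kernel_ge0 => // v; exact: majorant_ge0.
have -> : (M ^+ n.+1)%:E * f x + M%:E * m + \int[mu]_z K3 z =
    (M ^+ n.+1)%:E * f x + \int[mu]_z K2 z + \int[mu]_z K3 z.
  congr (_ + _ + _); rewrite /K2 ge0_integralZr//.
  - by rewrite ge0_integral_rV_subr// A_integral muleA -EFinM mulrC.
  - exact: measurableT_comp A_measurable (measurable_rV_addr _).
  - by rewrite mule_ge0// lee_fin maxC_ge0.
apply: (@le_trans _ _ (\int[mu]_z (K1 z + K2 z + K3 z))).
  apply: ge0_le_integral => //.
  - by move=> z _; exact: rconv_kernel_ge0.
  - apply: measurable_kernel_section; apply: measurable_rconv_kernel => //.
    exact: measurable_graph_full.
  - by apply: emeasurable_funD => //; exact: emeasurable_funD.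
  move=> z _; rewrite /rconv_kernel/= indicE mem_set// mule1.
  have [z1|z1] := leP (core_radius x) (enorm (y' - z)).
    apply: (@le_trans _ _ (K1 z)); first by rewrite lee_wpmul2r// A_core.
    by rewrite -addeA leeDl// adde_ge0.
  have [z2|z2] := leP (core_radius x) (enorm z).
    apply: (@le_trans _ _ (K2 z)); last by rewrite addeAC leeDr// adde_ge0.
    rewrite /K2 (A_isotropic (enormB z y')) lee_wpmul2l//.
    exact: conv_core.
  apply: (@le_trans _ _ (K3 z)); last by rewrite leeDr// adde_ge0.
  have xz := hy' z z2.
  rewrite /K3 /rconv_kernel/= indicE mem_set ?mule1; last first.
    by apply: core_D => //; exact: le_lt_trans xz z1.
  by apply: lee_pmul => //; [exact: A_decreasing|exact: IH].
rewrite ge0_integralD//; last 2 first.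
- by move=> z _; rewrite adde_ge0.
- exact: emeasurable_funD.
rewrite ge0_integralD// leeD2r// leeD2r//.
rewrite /K1 ge0_integralZl//; last by rewrite mule_ge0// lee_fin maxC_ge0.
rewrite integral_chain// A_integral -muleA muleC -muleA.
rewrite -EFin_expe -EFinM muleC lee_wpmul2r// lee_fin.
(* C <= C ^ (n + 1), as C >= 1. *)
rewrite exprMn mulrC ler_wpM2r ?exprn_ge0 ?L1norm_ge0//.
by rewrite exprS ler_peMr ?maxC_ge0// exprn_ege1// maxC_ge1.
Qed.

End estimates.

(** * Exponential generating functions *)

Section egf.
Context {R : realType}.
Implicit Types (u : (\bar R)^nat) (lambda : R).

Lemma nneseries_le (u : (\bar R)^nat) B : (forall n, 0 <= u n) ->
  (forall K, \sum_(0 <= n < K) u n <= B) -> \sum_(0 <= n <oo) u n <= B.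
Proof.
move=> u0 uB; apply: lime_le; first exact: is_cvg_nneseries.
exact: nearW.
Qed.

Lemma expR_partial_sum_le (x : R) K : (0 <= x)%R ->
  (\sum_(0 <= j < K) x ^+ j / j`!%:R <= expR x)%R.
Proof.
move=> x0; apply: (@nondecreasing_cvgn_le _ (series (exp_coeff x))).
  apply/nondecreasing_seqP => n; rewrite /series/= big_nat_recr//= lerDl.
  exact: exp_coeff_ge0.
exact: is_cvg_series_exp_coeff.
Qed.

(** Indexed from 0, with u n standing for the coefficient of order n + 1. *)
Definition egf lambda u : \bar R :=
  \sum_(0 <= n <oo) (lambda ^+ n.+1 / n.+1`!%:R)%:E * u n.

Lemma egf_coef_ge0 lambda n : (0 <= lambda)%R ->
  0 <= (lambda ^+ n / n`!%:R)%:E.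
Proof. by move=> l0; rewrite lee_fin divr_ge0// exprn_ge0. Qed.

Lemma egfE lambda u : (0 <= lambda)%R -> (forall n, 0 <= u n) ->
  \sum_(1 <= n <oo) (lambda ^+ n / n`!%:R)%:E * u n =
  egf lambda (fun n => u n.+1).
Proof.
move=> l0 u0; rewrite -nneseries_addn; last first.
  by move=> i; rewrite mule_ge0 ?egf_coef_ge0.
by congr (limn _); apply/funext => K; apply: eq_bigr => n _; rewrite addn1.
Qed.

Lemma egf_le lambda u v : (0 <= lambda)%R -> (forall n, 0 <= u n) ->
  (forall n, u n <= v n) -> egf lambda u <= egf lambda v.
Proof.
move=> l0 u0 uv; apply: lee_nneseries => n *.
  by rewrite mule_ge0 ?egf_coef_ge0.
by rewrite lee_wpmul2l ?egf_coef_ge0.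
Qed.

Lemma egf_ge_first lambda u : (0 <= lambda)%R -> (forall n, 0 <= u n) ->
  lambda%:E * u 0%N <= egf lambda u.
Proof.
move=> l0 u0; have := @nneseries_lim_ge R
  (fun n => (lambda ^+ n.+1 / n.+1`!%:R)%:E * u n) xpredT 0 1.
rewrite big_nat1 expr1 divr1; apply => n *.
by rewrite mule_ge0 ?egf_coef_ge0.
Qed.

Lemma egf_first lambda u : (0 <= lambda)%R -> 0 <= u 0%N ->
  (forall n, u n.+1 = 0) -> egf lambda u = lambda%:E * u 0%N.
Proof.
move=> l0 u0 uS; have u_ge0 n : 0 <= u n by case: n => // n; rewrite uS.
apply/eqP; rewrite eq_le egf_ge_first// andbT; apply: nneseries_le => [n|[|K]].
- by rewrite mule_ge0 ?egf_coef_ge0.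
- by rewrite big_nil mule_ge0.
rewrite big_nat_recl// expr1 divr1 big1_seq ?adde0// => i _.
by rewrite uS mule0.
Qed.

(** From 1/(n+1)! <= 1/n!. *)
Lemma egf_geometric lambda N (B : R) :
  (0 <= lambda)%R -> (0 <= N)%R -> (0 <= B)%R ->
  egf lambda (fun n => (B * N ^+ n)%:E) <= (lambda * B * expR (lambda * N))%:E.
Proof.
move=> l0 N0 B0; apply: nneseries_le => [n|K].
  by rewrite mule_ge0 ?egf_coef_ge0// lee_fin mulr_ge0// exprn_ge0.
have lN : (0 <= lambda * N)%R by rewrite mulr_ge0.
under eq_bigr do rewrite -EFinM.
rewrite sumEFin lee_fin.
apply: (@le_trans _ _
  (lambda * B * \sum_(0 <= n < K) (lambda * N) ^+ n / n`!%:R)%R);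
  last by rewrite ler_wpM2l ?mulr_ge0// expR_partial_sum_le.
rewrite mulr_sumr; apply: ler_sum => n _.
rewrite exprS exprMn.
rewrite [leLHS](_ : _ =
  lambda * B * (lambda ^+ n * N ^+ n) / n.+1`!%:R)%R; last by ring.
rewrite [leRHS]mulrA ler_wpM2l// ?mulr_ge0 ?exprn_ge0//.
rewrite lef_pV2 ?posrE ?ltr0n ?fact_gt0// ler_nat factS.
by rewrite leq_pmull.
Qed.

(** The left side is a Cauchy product: the coefficient of u k in the term of order
    n is the product of lambda^(k+1)/(k+1)! and (M lambda)^(n-k)/(n-k)!.  Exchanging
    the finite sums leaves, for each k, a partial sum of exp(M lambda). *)
Lemma egf_binomial lambda M u : (0 <= lambda)%R -> (0 <= M)%R ->
  (forall n, 0 <= u n) ->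
  egf lambda (fun n =>
    \sum_(k < n.+1) ('C(n.+1, k.+1)%:R * M ^+ (n - k))%:E * u k)
  <= (expR (M * lambda))%:E * egf lambda u.
Proof.
move=> l0 M0 u0.
have c0 n k : 0 <= ('C(n.+1, k.+1)%:R * M ^+ (n - k))%:E.
  by rewrite lee_fin mulr_ge0// exprn_ge0.
have Ml : (0 <= M * lambda)%R by rewrite mulr_ge0.
pose b j : R := ((M * lambda) ^+ j / j`!%:R)%R.
pose a k : R := (lambda ^+ k.+1 / k.+1`!%:R)%R.
have a0 k : 0 <= (a k)%:E by exact: egf_coef_ge0.
have b0 j : 0 <= (b j)%:E by exact: egf_coef_ge0.
apply: nneseries_le => [n|K].
  by rewrite mule_ge0 ?egf_coef_ge0// sume_ge0// => k _; rewrite mule_ge0.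
apply: (@le_trans _ _
  ((expR (M * lambda))%:E * \sum_(0 <= k < K) (a k)%:E * u k)); last first.
  rewrite lee_wpmul2l ?lee_fin ?expR_ge0//.
  by apply: nneseries_lim_ge => k *; rewrite mule_ge0.
rewrite ge0_sume_distrr; last by move=> k _; rewrite mule_ge0.
have -> : \sum_(0 <= n < K) (a n)%:E *
      (\sum_(k < n.+1) ('C(n.+1, k.+1)%:R * M ^+ (n - k))%:E * u k) =
    \sum_(0 <= n < K) \sum_(0 <= k < K | (k < n.+1)%N)
      (b (n - k)%N)%:E * ((a k)%:E * u k).
  rewrite big_nat [RHS]big_nat; apply: eq_bigr => n /= nK.
  rewrite ge0_sume_distrr; last by move=> k _; rewrite mule_ge0.
  rewrite -(big_mkord xpredT (fun k =>
    (a n)%:E * (('C(n.+1, k.+1)%:R * M ^+ (n - k))%:E * u k))).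
  rewrite (big_nat_widen 0 n.+1 K)//=; apply: eq_bigr => k kn.
  rewrite !muleA -!EFinM; congr (_%:E * _).
  have fne m : m`!%:R != 0%R :> R by rewrite pnatr_eq0 -lt0n fact_gt0.
  have binE : (n.+1`!%:R =
      'C(n.+1, k.+1)%:R * (k.+1`!%:R * (n - k)`!%:R) :> R)%R.
    by rewrite -natrM -natrM -(bin_fact kn) subSS.
  have bin0 : 'C(n.+1, k.+1)%:R != 0%R :> R by rewrite pnatr_eq0 -lt0n bin_gt0.
  have powE : (lambda ^+ n.+1 = lambda ^+ (n - k) * lambda ^+ k.+1)%R.
    by rewrite -exprD addnS subnK.
  rewrite /a /b exprMn binE powE.
  by field; rewrite bin0 !fne.
rewrite (exchange_big_dep_nat xpredT)//=.
apply: lee_sum => k _.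
rewrite -ge0_sume_distrl; last by move=> n _; exact: b0.
rewrite lee_wpmul2r ?mule_ge0// sumEFin lee_fin.
have -> : (\sum_(0 <= n < K | (k < n.+1)%N) b (n - k)%N =
    \sum_(0 <= j < K - k) b j)%R.
  under eq_bigl do rewrite ltnS.
  rewrite -(big_nat_widenl k 0 K xpredT)// -{1}(add0n k) big_addn.
  by apply: eq_bigr => j _; rewrite addnK.
exact: expR_partial_sum_le.
Qed.

End egf.

(** * Bounds for the compound Poisson density *)

Section conclusion.
Context {R : realType} {d : nat}.
Notation V := ('rV[R]_d).
Notation mu := (@lebesgue_rV R d).
Variables (f : V -> \bar R) (C1 C2 : R).
Hypothesis fA : assumption_A f C1 C2.
Implicit Types (x y z : V).
Notation N := (L1norm f).
Notation M := (Num.max C1 C2 * L1norm f)%R.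
Notation Fstar := (chain (@full R d) f).
Notation H := (chain (@D_set R d) f).

Let f0 := A_ge0 fA.
Let mf := A_measurable fA.

Lemma compound_poissonE lambda x : (0 <= lambda)%R ->
  compound_poisson f lambda x =
  (expR (- lambda * N))%:E * egf lambda (fun n => Fstar n x).
Proof.
move=> l0; rewrite /compound_poisson egfE//.
by case=> [|n]; [exact: f0|exact: chain_ge0].
Qed.

Lemma egf_conv_le lambda x : (0 <= lambda)%R ->
  egf lambda (fun n => Fstar n x) <=
  (expR (M * lambda))%:E * egf lambda (fun n => H n x).
Proof.
move=> l0; apply: (@le_trans _ _ (egf lambda (fun n => majorant f C1 C2 n x))).
  by apply: egf_le => // n; [exact: chain_ge0|exact: conv_le_majorant].
by apply: egf_binomial => //; [exact: (M2_ge0 fA)|move=> n; exact: chain_ge0].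
Qed.

(** On D(x) the increment satisfies |x-z| > 1, so the outermost factor is at most
    B; the remaining factors integrate to at most ||f||^n. *)
Lemma chain_le_geometric x n (B : R) : (1 <= enorm x)%R -> (0 <= B)%R ->
  (forall z, (1 <= enorm z)%R -> f z <= B%:E) ->
  H n x <= (B * N ^+ n)%:E.
Proof.
move=> x1 B0 fB; case: n => [|n]; first by rewrite mulr1; exact: fB.
have mH := measurable_chain n (@measurable_graph_D R d) mf f0.
have mF := measurable_chain n (@measurable_graph_full R d) mf f0.
have H0 k y : 0 <= H k y by exact: chain_ge0.
have F0 k y : 0 <= Fstar k y by exact: chain_ge0.
rewrite chainS rconvE EFinM EFin_expe -(A_integral fA) -integral_chain//.
rewrite -ge0_integralZl//.
apply: ge0_le_integral => //.
- by move=> z _; exact: rconv_kernel_ge0.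
- apply: measurable_kernel_section; apply: measurable_rconv_kernel => //.
  exact: measurable_graph_D.
- exact: measurable_funeM.
move=> z _; rewrite /rconv_kernel/= indicE.
have [|_] := boolP ((x, z) \in _); last by rewrite mule0 mule_ge0// lee_fin.
rewrite inE => -[/= zx xzx]; rewrite mule1; apply: lee_pmul => //.
  by apply: fB; have := enorm_subr_ge x z; lra.
by apply: chain_le_full => //; exact: measurable_graph_D.
Qed.

Lemma egf_chain_lty lambda x : (0 <= lambda)%R -> (1 <= enorm x)%R ->
  egf lambda (fun n => H n x) < +oo.
Proof.
move=> l0 x1; have xp : (0 < enorm x)%R by exact: lt_le_trans x1.
pose e := ((enorm x)^-1 *: x)%R.
have e1 : enorm e = 1%R.
  by rewrite enormZ ger0_norm ?invr_ge0 ?enorm_ge0// mulVf// gt_eqF.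
have e0 : e != 0%R.
  by apply/eqP => e0; move: e1; rewrite e0 enorm0 => /eqP; rewrite eq_sym oner_eq0.
have fe : (fine (f e))%:E = f e by rewrite fineK// ge0_fin_numE// (A_finite fA).
apply: (@le_lt_trans _ _ (egf lambda (fun n => (fine (f e) * N ^+ n)%:E))).
  apply: egf_le => // n; first exact: chain_ge0.
  apply: chain_le_geometric => //; first exact: fine_ge0.
  by move=> z z1; rewrite fe; apply: (A_decreasing fA); rewrite e1.
apply: le_lt_trans (egf_geometric l0 (L1norm_ge0 fA) (fine_ge0 (f0 e))) _.
exact: ltry.
Qed.

(** Finiteness of Q matters: for Q = +oo the quotient would be 0. *)
Lemma ratio_bounds (c K : R) (P Q : \bar R) : (0 < c)%R -> 0 < Q < +oo ->
  Q <= P -> P <= K%:E * Q ->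
  1 <= c%:E * P / (c%:E * Q) /\ c%:E * P / (c%:E * Q) <= K%:E.
Proof.
move=> c0 /andP[]; case: Q => [q|//|//]; rewrite lte_fin => q0 _ QP PQ.
have cq : (0 < c * q)%R by rewrite mulr_gt0.
rewrite -EFinM inver gt_eqF//; split.
  by rewrite lee_pdivlMr// mul1e EFinM lee_wpmul2l// lee_fin ltW.
by rewrite lee_pdivrMr// EFinM muleCA lee_wpmul2l// lee_fin ltW.
Qed.

(** Common to h (S = D_set) and g (S = E_set): the series attached to S lies
    between the one attached to D_set and the one of the convolution powers, and
    the latter is at most e^(M lambda) times the former. *)
Lemma restricted_ratio (S : V -> set V) lambda x :
  measurable (graph S) -> S 0%R = set0 -> (forall z, D_set z `<=` S z) ->
  (1 <= enorm x)%R -> (0 < lambda)%R ->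
  let ratio := compound_poisson f lambda x /
    ((expR (- lambda * N))%:E * f x *
     \sum_(1 <= n <oo)
       (lambda ^+ n / n`!%:R)%:E * iter n.-1 (hg_step S f) (cst 1) x) in
  1 <= ratio /\ ratio <= (expR (M * lambda))%:E.
Proof.
move=> mS S0 DS x1 l0 ratio; have l0' := ltW l0.
have x0 : x != 0%R.
  by apply: contraTneq x1 => ->; rewrite enorm0 -ltNge.
have fx : f x \is a fin_num by rewrite ge0_fin_numE// (A_finite fA).
have hg0 n y : 0 <= iter n (hg_step S f) (cst 1) y.
  elim: n y => [|n IH] y //=.
  rewrite mule_ge0 ?inve_ge0//; apply: integral_ge0 => z _.
  by rewrite !mule_ge0.
have chainE n : chain S f n x = f x * iter n (hg_step S f) (cst 1) x.
  apply: chain_hg => // y y0; apply/andP; split;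
    [exact: A_pos fA y|exact: A_finite fA y y0].
rewrite /ratio -[X in _ / X]muleA.
have -> : f x * \sum_(1 <= n <oo) (lambda ^+ n / n`!%:R)%:E *
      iter n.-1 (hg_step S f) (cst 1) x = egf lambda (fun n => chain S f n x).
  rewrite (egfE (u := fun n => iter n.-1 (hg_step S f) (cst 1) x))//.
  rewrite /egf -(fineK fx) -nneseriesZl; last first.
    by move=> n _; rewrite mule_ge0// egf_coef_ge0.
  congr (limn _); apply/funext => K; apply: eq_bigr => n _.
  by rewrite muleCA chainE fineK.
have H0 n y : 0 <= H n y by exact: chain_ge0.
have S_ge0 n y : 0 <= chain S f n y by exact: chain_ge0.
have mgD := @measurable_graph_D R d.
have HS n y : H n y <= chain S f n y.
  elim: n y => [|n IH] y; first exact: lexx.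
  by rewrite !chainS; apply: rconv_le => //; exact: measurable_chain.
have Q0 : 0 < egf lambda (fun n => chain S f n x).
  apply: lt_le_trans (egf_ge_first l0' (fun n => S_ge0 n x)).
  by rewrite mule_gt0 ?lte_fin//; exact: A_pos fA x.
have QP : egf lambda (fun n => chain S f n x) <= egf lambda (fun n => Fstar n x).
  by apply: egf_le => // n; exact: chain_le_full.
have PH := egf_conv_le x l0'.
have HQ : egf lambda (fun n => H n x) <= egf lambda (fun n => chain S f n x).
  exact: egf_le.
rewrite compound_poissonE//; apply: ratio_bounds => //.
- exact: expR_gt0.
- rewrite Q0/=; apply: (le_lt_trans QP); apply: (le_lt_trans PH).
  by rewrite lte_mul_pinfty ?lee_fin ?expR_ge0 ?egf_chain_lty.
- by apply: (le_trans PH); rewrite lee_wpmul2l// lee_fin expR_ge0.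
Qed.

Lemma compound_poisson_unit_ball lambda x : (enorm x < 1)%R -> (0 < lambda)%R ->
  (lambda * expR (- lambda * N))%:E * f x <= compound_poisson f lambda x /\
  compound_poisson f lambda x <= (expR ((M - N) * lambda) * lambda)%:E * f x.
Proof.
move=> x1 l0; have l0' := ltW l0.
rewrite compound_poissonE//; split.
  rewrite mulrC EFinM -muleA lee_wpmul2l ?lee_fin ?expR_ge0//.
  by apply: (egf_ge_first l0' (u := fun n => Fstar n x)) => n; exact: chain_ge0.
apply: (@le_trans _ _ ((expR (- lambda * N))%:E *
    ((expR (M * lambda))%:E * egf lambda (fun n => H n x)))).
  by rewrite lee_wpmul2l ?lee_fin ?expR_ge0// egf_conv_le.
rewrite (@egf_first _ lambda (fun n => H n x))//.
  rewrite !muleA -!EFinM -expRD le_eqVlt; apply/orP; left; apply/eqP.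
  by congr ((expR _ * _)%:E * _); ring.
move=> n; rewrite chainS /rconv (_ : D_set x = set0) ?integral_set0//.
by apply/seteqP; split => z //= -[zx _]; have := enorm_ge0 z; lra.
Qed.

End conclusion.

Unset Implicit Arguments.
Set Strict Implicit.

Theorem corollary2p6 (R : realType) (d : nat) (d_ge1 : (1 <= d)%N)
    (f : 'rV[R]_d -> \bar R) (C1 C2 : R) (fA : assumption_A f C1 C2) :
  let M2 : R := (Num.max C1 C2 * L1norm f)%R in
  [/\ forall (x : 'rV[R]_d) (lambda : R), (enorm x < 1)%R -> (0 < lambda)%R ->
        (lambda * expR (- lambda * L1norm f))%:E * f x
          <= compound_poisson f lambda x /\
        compound_poisson f lambda x
          <= (expR ((M2 - L1norm f) * lambda) * lambda)%:E * f x,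
      forall (x : 'rV[R]_d) (lambda : R), (1 <= enorm x)%R -> (0 < lambda)%R ->
        let ratio := compound_poisson f lambda x /
          ((expR (- lambda * L1norm f))%:E * f x *
           \sum_(1 <= n <oo) (lambda ^+ n / n`!%:R)%:E * h_fun f n x) in
        1 <= ratio /\ ratio <= (expR (M2 * lambda))%:E
    & forall (x : 'rV[R]_d) (lambda : R), (1 <= enorm x)%R -> (0 < lambda)%R ->
        let ratio := compound_poisson f lambda x /
          ((expR (- lambda * L1norm f))%:E * f x *
           \sum_(1 <= n <oo) (lambda ^+ n / n`!%:R)%:E * g_fun f n x) in
        1 <= ratio /\ ratio <= (expR (M2 * lambda))%:E].
Proof.
have D0 : D_set (0 : 'rV[R]_d)%R = set0.
  by apply/seteqP; split => z //= -[]; rewrite enorm0; have := enorm_ge0 z; lra.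
have E0 : E_set (0 : 'rV[R]_d)%R = set0.
  by apply/seteqP; split => z //= -[]; rewrite enorm0; have := enorm_ge0 z; lra.
have DE (z : 'rV[R]_d) : D_set z `<=` E_set z by move=> y [zy yzy]; split; lra.
split=> x lambda.
- exact: compound_poisson_unit_ball.
- exact: (restricted_ratio fA (@measurable_graph_D R d) D0 (fun=> @subset_refl _ _)).
- exact: (restricted_ratio fA (@measurable_graph_E R d) E0 DE).
Qed.
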